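(* Let $N\geq 2$, let $\mathcal{P},\mathcal{M}$ be nonempty disjoint sets with $\mathcal{P}\cup\mathcal{M}=\{1,\dots,N\}$, and consider the linear time-invariant system $$\dot x(t)=Ax(t)+Bu(t),\quad x(0)=0,\quad y_i(t)=C_ix(t)+D_iu(t),\quad i\in\{1,\dots,N\},$$ with $A\in\mathbb{R}^{n\times n}$, $B\in\mathbb{R}^{n\times m}$, $C_i\in\mathbb{R}^{p_i\times n}$, $D_i\in\mathbb{R}^{p_i\times m}$, which is internally positive: $A$ is Metzler and $B\ge0$, $C_i\ge0$, $D_i\ge0$ elementwise for all $i$. Let $Q_i=Q_i^\top\succeq0$ ($i\in\mathcal{P}$), $R_j=R_j^\top\succeq0$ and $\delta_j>0$ ($j\in\mathcal{M}$). Consider $$(\mathrm{OP})\qquad\sup_{u\in\mathcal{L}_2^{0+}}\ \frac1{|\mathcal{P}|}\sum_{i\in\mathcal{P}}\int_0^\infty y_i(t)^\top Q_iy_i(t)\,dt\quad\text{s.t.}\quad\int_0^\infty y_j(t)^\top R_jy_j(t)\,dt\le\delta_j\quad\forall j\in\mathcal{M},$$ and the semidefinite program $$(\mathrm{SDP})\qquad\min_{\bm{\gamma},P}\ \sum_{j\in\mathcal{M}}\gamma_j\delta_j\quad\text{s.t.}\quad\begin{bmatrix}A^\top P+PA & PB \\ B^\top P & 0\end{bmatrix}+\Gamma\preceq0,\quad\bm{\gamma}\ge0,\quad P\succeq0,\quad\Gamma_{ij}\ge0\ \forall\,i\ne j,\quad\Gamma_{ii}\ge0\ \forall\,i\le n,$$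 where $P\in\mathbb{R}^{n\times n}$ is a diagonal matrix, $\bm{\gamma}\in\mathbb{R}^{|\mathcal{M}|}$ is the stacked vector of the $\gamma_j$, $\ge$ is elementwise, and $$\Gamma=\frac1{|\mathcal{P}|}\sum_{i\in\mathcal{P}}\begin{bmatrix}C_i^\top \\ D_i^\top\end{bmatrix}Q_i\begin{bmatrix}C_i & D_i\end{bmatrix}-\sum_{j\in\mathcal{M}}\gamma_j\begin{bmatrix}C_j^\top \\ D_j^\top\end{bmatrix}R_j\begin{bmatrix}C_j & D_j\end{bmatrix}$$ ($\Gamma_{ij}$ being the scalar entries of this $(n+m)\times(n+m)$ matrix). Let $\Sigma_p$ and $\Sigma_m$ denote the state-space systems with state equation $\dot x(t)=Ax(t)+Bu(t)$, $x(0)=0$, input $u$, and output vectors $$y_p=\frac1{\sqrt{|\mathcal{P}|}}\operatorname{col}_{i\in\mathcal{P}}\big(\sqrt{Q_i}\,y_i\big),\qquad y_m=\operatorname{col}_{j\in\mathcal{M}}\big(\sqrt{R_j}\,y_j\big),$$ respectively. Then: (a) The value of $(\mathrm{OP})$ is upper bounded by the value of $(\mathrm{SDP})$. (b) If $\Sigma_m$ has a zero on the imaginary axis that is not a zero of $\Sigma_p$, then the value of $(\mathrm{SDP})$ is unbounded (equal to $+\infty$).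
   Context: A matrix is Metzler if all its off-diagonal entries are nonnegative. $\mathcal{L}_2^{0+}$ is the set of signals $u:\mathbb{R}_+\to\mathbb{R}_+^m$ (elementwise nonnegative) with $\int_0^\infty u(t)^\top u(t)\,dt<\infty$ and $\lim_{t\to\infty}u(t)=0$. $\operatorname{col}$ denotes vertical stacking and $\sqrt{Q}$ the symmetric positive semidefinite square root. Zeros: $\beta\in\mathbb{C}$ is a (finite, invariant) zero of $\Sigma=(A,B,C,D)$ if there exist $x_0$ (of dimension $n$) and $g$ (of dimension $m$), complex-valued in general and not both zero, such that $\begin{bmatrix}\beta I-A & B \\ C & -D\end{bmatrix}\begin{bmatrix}x_0 \\ g\end{bmatrix}=\begin{bmatrix}0 \\ 0\end{bmatrix}$. Conventions: the value of a minimization problem with empty feasible set is $+\infty$ (this is what ''unbounded'' means for a minimization problem here); integrals of nonnegative functions may take the value $+\infty$. *)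

(* Defs.v *)
From HB Require Import structures.
From mathcomp Require Import all_boot all_order all_algebra.
From mathcomp Require Import all_classical all_reals all_analysis.
From mathcomp Require Import complex.
Import Order.TTheory GRing.Theory Num.Theory.
Import numFieldNormedType.Exports.

Set Implicit Arguments.
Unset Strict Implicit.
Unset Printing Implicit Defensive.

Local Open Scope classical_set_scope.
Local Open Scope ring_scope.
Local Open Scope complex_scope.

Definition metzler (R : realType) (n : nat) (A : 'M[R]_n) : Prop :=
  forall i j : 'I_n, i != j -> 0 <= A i j.

Definition nonneg_mx (R : realType) (m n : nat) (A : 'M[R]_(m, n)) : Prop :=
  forall i j, 0 <= A i j.

Definition qform (R : realType) (n : nat) (Q : 'M[R]_n) (v : 'cV[R]_n) : R :=
  (v^T *m Q *m v) 0 0.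

Definition psdmx (R : realType) (n : nat) (Q : 'M[R]_n) : Prop :=
  Q^T = Q /\ forall v : 'cV[R]_n, 0 <= qform Q v.

Definition nsdmx (R : realType) (n : nat) (Q : 'M[R]_n) : Prop := psdmx (- Q).

(* For positive semidefinite Q such an S exists and is unique; for any other Q
   the value is the irrelevant default 0. *)
Definition psd_sqrt (R : realType) (n : nat) (Q : 'M[R]_n) : 'M[R]_n :=
  xget 0 [set S : 'M[R]_n | psdmx S /\ S *m S = Q].

(* Signals on R_+ are represented by functions on R of which only the values
   on [0, +oo[ are used. *)
Definition L2_0plus (R : realType) (m : nat) (u : R -> 'cV[R]_m) : Prop :=
  [/\ forall k : 'I_m, measurable_fun (`[0, +oo[ : set R) (fun t : R => u t k 0),
      forall (t : R) (k : 'I_m), 0 <= t -> 0 <= u t k 0,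
      (\int[lebesgue_measure]_(t in `[0%R, +oo[)
         (((u t)^T *m u t) 0 0)%:E < +oo)%E &
      u t @[t --> +oo] --> (0 : 'cV[R]_m)].

Definition vector_field (R : realType) (n m : nat) (A : 'M[R]_n)
    (B : 'M[R]_(n, m)) (u : R -> 'cV[R]_m) (x : R -> 'cV[R]_n) (t : R)
    : 'cV[R]_n :=
  A *m x t + B *m u t.

(* x is the (Caratheodory) solution of x' = A x + B u, x(0) = 0 on [0, +oo[:
   as u is only measurable, the equation is read in integrated form.
   Integrability is required explicitly because the library's integral is a
   total function. *)
Definition trajectory (R : realType) (n m : nat) (A : 'M[R]_n)
    (B : 'M[R]_(n, m)) (u : R -> 'cV[R]_m) (x : R -> 'cV[R]_n) : Prop :=
  forall (t : R) (k : 'I_n), 0 <= t ->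
    lebesgue_measure.-integrable `[0, t]
      (fun s : R => (vector_field A B u x s k 0)%:E) /\
    x t k 0 = \int[lebesgue_measure]_(s in `[0, t]) vector_field A B u x s k 0.

(* The integral over [0, +oo[ of y^T Q y for the output y = C x + D u. *)
Definition output_energy (R : realType) (n m p : nat) (C : 'M[R]_(p, n))
    (D : 'M[R]_(p, m)) (Q : 'M[R]_p) (u : R -> 'cV[R]_m) (x : R -> 'cV[R]_n)
    : \bar R :=
  (\int[lebesgue_measure]_(t in `[0%R, +oo[)
     (qform Q (C *m x t + D *m u t))%:E)%E.

Definition op_feasible (R : realType) (N n m : nat) (MM : {set 'I_N})
    (p : 'I_N -> nat) (A : 'M[R]_n) (B : 'M[R]_(n, m))
    (C : forall i : 'I_N, 'M[R]_(p i, n)) (D : forall i : 'I_N, 'M[R]_(p i, m))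
    (Rw : forall j : 'I_N, 'M[R]_(p j)) (delta : 'I_N -> R)
    (u : R -> 'cV[R]_m) (x : R -> 'cV[R]_n) : Prop :=
  [/\ L2_0plus u, trajectory A B u x &
      forall j : 'I_N, j \in MM ->
        (output_energy (C j) (D j) (Rw j) u x <= (delta j)%:E)%E].

Definition op_value (R : realType) (N n m : nat) (PP MM : {set 'I_N})
    (p : 'I_N -> nat) (A : 'M[R]_n) (B : 'M[R]_(n, m))
    (C : forall i : 'I_N, 'M[R]_(p i, n)) (D : forall i : 'I_N, 'M[R]_(p i, m))
    (Q Rw : forall i : 'I_N, 'M[R]_(p i)) (delta : 'I_N -> R) : \bar R :=
  ereal_sup [set J : \bar R | exists (u : R -> 'cV[R]_m) (x : R -> 'cV[R]_n),
    op_feasible MM A B C D Rw delta u x /\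
    J = ((#|PP|%:R^-1)%:E *
         \sum_(i in PP) output_energy (C i) (D i) (Q i) u x)%E].

Definition output_gram (R : realType) (n m p : nat) (C : 'M[R]_(p, n))
    (D : 'M[R]_(p, m)) (Q : 'M[R]_p) : 'M[R]_(n + m) :=
  col_mx C^T D^T *m Q *m row_mx C D.

Definition Gamma_mx (R : realType) (N n m : nat) (PP MM : {set 'I_N})
    (p : 'I_N -> nat)
    (C : forall i : 'I_N, 'M[R]_(p i, n)) (D : forall i : 'I_N, 'M[R]_(p i, m))
    (Q Rw : forall i : 'I_N, 'M[R]_(p i)) (gamma : 'I_N -> R)
    : 'M[R]_(n + m) :=
  #|PP|%:R^-1 *: (\sum_(i in PP) output_gram (C i) (D i) (Q i))
  - \sum_(j in MM) gamma j *: output_gram (C j) (D j) (Rw j).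

(* The multiplier vector (gamma_j), j in MM, is given by a function on all
   indices of which only the values on MM occur. *)
Definition sdp_feasible (R : realType) (N n m : nat) (PP MM : {set 'I_N})
    (p : 'I_N -> nat) (A : 'M[R]_n) (B : 'M[R]_(n, m))
    (C : forall i : 'I_N, 'M[R]_(p i, n)) (D : forall i : 'I_N, 'M[R]_(p i, m))
    (Q Rw : forall i : 'I_N, 'M[R]_(p i)) (gamma : 'I_N -> R) (P : 'M[R]_n)
    : Prop :=
  let Gamma := Gamma_mx PP MM C D Q Rw gamma in
  [/\ nsdmx (block_mx (A^T *m P + P *m A) (P *m B) (B^T *m P) 0 + Gamma),
      forall j : 'I_N, j \in MM -> 0 <= gamma j,
      is_diag_mx P /\ psdmx P,
      forall k l : 'I_(n + m), k != l -> 0 <= Gamma k l &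
      forall k : 'I_n, 0 <= Gamma (lshift m k) (lshift m k)].

Definition sdp_value (R : realType) (N n m : nat) (PP MM : {set 'I_N})
    (p : 'I_N -> nat) (A : 'M[R]_n) (B : 'M[R]_(n, m))
    (C : forall i : 'I_N, 'M[R]_(p i, n)) (D : forall i : 'I_N, 'M[R]_(p i, m))
    (Q Rw : forall i : 'I_N, 'M[R]_(p i)) (delta : 'I_N -> R) : \bar R :=
  ereal_inf [set J : \bar R | exists (gamma : 'I_N -> R) (P : 'M[R]_n),
    sdp_feasible PP MM A B C D Q Rw gamma P /\
    J = (\sum_(j in MM) gamma j * delta j)%:E].

(* col_{i in S} (sqrt(W_i) K_i), stacked in increasing order of i: applied to
   the C_i and to the D_i, it gives the output matrices of the stacked output
   col_{i in S} (sqrt(W_i) y_i). *)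
Definition weighted_stack (R : realType) (N n : nat) (S : {set 'I_N})
    (p : 'I_N -> nat) (W : forall i : 'I_N, 'M[R]_(p i))
    (K : forall i : 'I_N, 'M[R]_(p i, n))
    : 'M[R]_(\sum_(k < #|S|) p (enum_val k), n) :=
  \mxcol_(k < #|S|) (psd_sqrt (W (enum_val k)) *m K (enum_val k)).

Definition system_zero (R : realType) (n m p : nat) (A : 'M[R]_n)
    (B : 'M[R]_(n, m)) (C : 'M[R]_(p, n)) (D : 'M[R]_(p, m)) (beta : R[i])
    : Prop :=
  exists (x0 : 'cV[R[i]]_n) (g : 'cV[R[i]]_m),
    ~ (x0 = 0 /\ g = 0) /\
    block_mx (beta%:M - map_mx (real_complex R) A) (map_mx (real_complex R) B)
             (map_mx (real_complex R) C) (- map_mx (real_complex R) D)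
      *m col_mx x0 g = 0.

Definition zero_of_Sigma_p (R : realType) (N n m : nat) (PP : {set 'I_N})
    (p : 'I_N -> nat) (A : 'M[R]_n) (B : 'M[R]_(n, m))
    (C : forall i : 'I_N, 'M[R]_(p i, n)) (D : forall i : 'I_N, 'M[R]_(p i, m))
    (Q : forall i : 'I_N, 'M[R]_(p i)) (beta : R[i]) : Prop :=
  system_zero A B ((Num.sqrt #|PP|%:R)^-1 *: weighted_stack PP Q C)
                  ((Num.sqrt #|PP|%:R)^-1 *: weighted_stack PP Q D) beta.

Definition zero_of_Sigma_m (R : realType) (N n m : nat) (MM : {set 'I_N})
    (p : 'I_N -> nat) (A : 'M[R]_n) (B : 'M[R]_(n, m))
    (C : forall i : 'I_N, 'M[R]_(p i, n)) (D : forall i : 'I_N, 'M[R]_(p i, m))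
    (Rw : forall j : 'I_N, 'M[R]_(p j)) (beta : R[i]) : Prop :=
  system_zero A B (weighted_stack MM Rw C) (weighted_stack MM Rw D) beta.

(* Main.v *)
Require Import Defs.
From HB Require Import structures.
From mathcomp Require Import all_boot all_order all_algebra.
From mathcomp Require Import all_classical all_reals all_analysis.
From mathcomp Require Import complex spectral sesquilinear measurable_realfun.
From mathcomp Require Import ring lra.
Import Order.TTheory GRing.Theory Num.Theory.
Import numFieldNormedType.Exports.

Set Implicit Arguments.
Unset Strict Implicit.
Unset Printing Implicit Defensive.

Local Open Scope classical_set_scope.
Local Open Scope ring_scope.
Local Open Scope complex_scope.

(* For a multiplier P feasible in (SDP), the matrix inequality reads
     d/dt (x^T P x) + y_p^T y_p <= sum_j gamma_j y_j^T R_j y_j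
   along trajectories.  Integrating over [0, T], dropping x(T)^T P x(T) >= 0 and
   letting T grow gives (a).  As u is only measurable, x is merely absolutely
   continuous; P being diagonal, the integration only needs
   x_k(T)^2 = 2 \int_0^T x_k x_k', which is Fubini on a triangle.
   For (b), evaluate the matrix inequality as a Hermitian form at (x0, -g) for a
   zero i w of Sigma_m: the storage term vanishes because i w is imaginary and
   the gamma_j terms because (x0, g) is output-zeroing for Sigma_m.  What is left
   is |y_p|^2 <= 0, so i w is a zero of Sigma_p.  The square roots in the
   definition of a zero are obtained as real
   polynomials in the weights. *)

(** * Square roots of positive semidefinite matrices by polynomial functional calculus *)

(** Newton interpolation: the product [w] vanishes at all earlier nodes but not at a new node [x],
    so adding a multiple of [w] corrects the value at [x] alone. A repeated node calls for no
    correction. *)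
Lemma exists_interpolation (F : fieldType) (f : F -> F) (s : seq F) :
  exists q : {poly F}, {in s, forall x, q.[x] = f x}.
Proof.
elim: s => [|x s [q hq]]; first by exists 0.
have [xs|xs] := boolP (x \in s).
  by exists q => y; rewrite inE => /predU1P[->|/hq//]; exact: hq.
pose w := \prod_(z <- s) ('X - z%:P).
have wx : w.[x] != 0.
  by have := root_prod_XsubC s x; rewrite rootE (negbTE xs) => ->.
exists (q + ((f x - q.[x]) / w.[x]) *: w) => y.
rewrite inE !hornerE => /predU1P[->|ys]; first by rewrite divfK // addrC subrK.
have /rootP -> : root w y by rewrite root_prod_XsubC.
by rewrite mulr0 addr0 hq.
Qed.

Lemma trmx_horner_mx (R : comNzRingType) (n : nat) (A : 'M[R]_n.+1)
    (q : {poly R}) : (horner_mx A q)^T = horner_mx A^T q.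
Proof.
elim/poly_ind: q => [|q c IH]; first by rewrite !rmorph0 trmx0.
rewrite !rmorphD !rmorphM /= !horner_mx_C !horner_mx_X linearD /= tr_scalar_mx.
by rewrite [(_ * A)^T]trmx_mul IH (comm_mx_horner q (erefl (A^T *m A^T))).
Qed.

Lemma qform_gram (R : realType) (p n : nat) (S : 'M[R]_(p, n)) (v : 'cV[R]_n) :
  qform (S^T *m S) v = \sum_k (S *m v) k 0 ^+ 2.
Proof.
rewrite /qform mulmxA -trmx_mul -mulmxA mxE.
by apply: eq_bigr => k _; rewrite mxE expr2.
Qed.

(** Eigenvectors here are rows [v], so the form is evaluated at [v^T], where it equals [r] times the
    squared norm of [v]. That norm is written as a Gram form of the identity to expose it as a sum
    of squares. *)
Lemma eigenvalue_psd_ge0 (R : realType) (n : nat) (Q : 'M[R]_n) (r : R) :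
  psdmx Q -> eigenvalue Q r -> 0 <= r.
Proof.
move=> [_ Q0] /eigenvalueP[v vQ v0].
have := Q0 v^T; rewrite /qform trmxK vQ -scalemxAl mxE.
have <- : qform 1%:M v^T = (v *m v^T) 0 0 by rewrite /qform mulmx1 trmxK.
rewrite -[1%:M]mulmx1 -[X in X *m _]trmx1 qform_gram mul1mx.
rewrite pmulr_lge0 // lt_def sumr_ge0 ?andbT; last by move=> k _; exact: sqr_ge0.
apply: contra v0 => /eqP h; apply/eqP/rowP => k; rewrite mxE.
have /psumr_eq0P/(_ h k isT)/eqP : forall k : 'I_n, true -> 0 <= v^T k 0 ^+ 2.
  by move=> *; exact: sqr_ge0.
by rewrite sqrf_eq0 mxE => /eqP.
Qed.

(* Over R[i], Q is unitarily diagonalizable with real spectrum, and a real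
   polynomial annihilating it there annihilates it over R. *)
Lemma symmetric_horner_eq0 (R : realType) (n : nat) (Q : 'M[R]_n.+1) :
  Q^T = Q -> exists s : seq R, all (eigenvalue Q) s /\
    forall q : {poly R}, {in s, forall x, q.[x] = 0} -> horner_mx Q q = 0.
Proof.
move=> Qs; pose QC := map_mx (real_complex R) Q.
have QCh : QC \is hermsymmx.
  apply: realsym_hermsym.
    by apply/is_hermitianmxP; rewrite scale1r map_mx_id// /QC map_trmx Qs.
  by apply/mxOverP => i j; rewrite mxE complex_real.
have /hermitian_normalmx/orthomx_spectralP := QCh.
have /mxOverP := hermitian_spectral_diag_real QCh.
set d := spectral_diag QC; set P := spectralmx QC => dr QE.
have Pu : P \in unitmx by exact: spectral_unit.
pose r j := complex.Re (d 0 j).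
have dE j : d 0 j = (r j)%:C by rewrite RRe_real.
exists [seq r j | j <- enum 'I_n.+1]; split.
  apply/allP => _ /mapP[j _ ->].
  rewrite -(eigenvalue_map (real_complex R)) /= -dE.
  (* Row [j] of the unitary matrix is a left eigenvector for [d 0 j]; it is nonzero because
     multiplying it by the inverse returns the unit row vector. *)
  apply/eigenvalueP; exists (row j P).
    rewrite -/QC QE -row_mul mulmxA mulKVmx // row_mul row_diag_mx.
    by rewrite -scalemxAl -rowE.
  apply/eqP => /(congr1 (mulmx^~ (invmx P))); rewrite mul0mx -row_mul mulmxV //.
  by move/matrixP/(_ 0 j)/eqP; rewrite !mxE eqxx oner_eq0.
move=> q q0; apply: (@map_mx_inj _ _ (real_complex R)).
rewrite map_horner_mx -/QC QE (horner_mx_uconjC _ _ Pu) horner_mx_diag.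
rewrite (_ : map_mx _ d = 0); last first.
  apply/rowP => j; rewrite !mxE dE horner_map /= q0 //.
  by apply/mapP; exists j => //; rewrite mem_enum.
have -> : diag_mx (0 : 'rV[R[i]]_n.+1) = 0 by exact: raddf0.
by rewrite mulmx0 mul0mx map_mx0.
Qed.

(** [psd_sqrt] is a choice with default 0, so its specification holds once some root exists. The
    root is a polynomial in [Q] that interpolates the scalar root on the spectrum. *)
Lemma psd_sqrtP (R : realType) (n : nat) (Q : 'M[R]_n) : psdmx Q ->
  psdmx (psd_sqrt Q) /\ psd_sqrt Q *m psd_sqrt Q = Q.
Proof.
move=> Qpsd; rewrite /psd_sqrt.
suff [S HS] : exists S : 'M[R]_n, psdmx S /\ S *m S = Q.
  by case: xgetP => [T _ //|/(_ S)]; case.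
case: n => [|n] in Q Qpsd *.
  by exists Q; split=> //; apply/matrixP => -[].
have [Qs _] := Qpsd.
have [s [/allP seig annih]] := symmetric_horner_eq0 Qs.
(* Fourth roots, so that the square root is itself a Gram matrix, hence PSD. *)
have [q qE] := exists_interpolation (fun x => Num.sqrt (Num.sqrt x)) s.
pose T := horner_mx Q q.
have Ts : T^T = T by rewrite trmx_horner_mx Qs.
exists (T *m T); split.
  split; first by rewrite trmx_mul Ts.
  move=> v; rewrite -{1}Ts qform_gram sumr_ge0 // => k _; exact: sqr_ge0.
(* The polynomial [q ^ 4 - X] vanishes at every listed eigenvalue, all of which are nonnegative,
   hence it annihilates [Q]. *)
apply/eqP; rewrite -subr_eq0; apply/eqP.
have := annih (q * q * (q * q) - 'X); rewrite rmorphB !rmorphM /= horner_mx_X.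
apply=> x xs; have x0 := eigenvalue_psd_ge0 Qpsd (seig _ xs).
rewrite hornerD hornerN hornerX !hornerM qE // -!expr2.
by rewrite !sqr_sqrtr ?sqrtr_ge0// subrr.
Qed.

(** * Quadratic forms, the dissipation inequality and stacked outputs *)

Section quadratic_forms.
Context (R : realType).

Lemma qformD n (P Q : 'M[R]_n) v : qform (P + Q) v = qform P v + qform Q v.
Proof. by rewrite /qform mulmxDr mulmxDl mxE. Qed.

Lemma qformZ n c (Q : 'M[R]_n) v : qform (c *: Q) v = c * qform Q v.
Proof. by rewrite /qform -scalemxAr -scalemxAl mxE. Qed.

Lemma qformN n (Q : 'M[R]_n) v : qform (- Q) v = - qform Q v.
Proof. by rewrite /qform mulmxN mulNmx mxE. Qed.

Lemma qform_sum n (I : Type) (s : seq I) (P : pred I) (Q : I -> 'M[R]_n) v :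
  qform (\sum_(i <- s | P i) Q i) v = \sum_(i <- s | P i) qform (Q i) v.
Proof. by rewrite /qform mulmx_sumr mulmx_suml summxE. Qed.

Lemma qform_output_gram n m p (C : 'M[R]_(p, n)) (D : 'M[R]_(p, m)) Q x u :
  qform (output_gram C D Q) (col_mx x u) = qform Q (C *m x + D *m u).
Proof.
rewrite /qform /output_gram -tr_row_mx !mulmxA -trmx_mul -!mulmxA.
by rewrite mul_row_col !mulmxA.
Qed.

Lemma qform_Gamma N n m (PP MM : {set 'I_N}) (p : 'I_N -> nat)
    (C : forall i, 'M[R]_(p i, n)) (D : forall i, 'M[R]_(p i, m))
    (Q Rw : forall i, 'M[R]_(p i)) (gamma : 'I_N -> R) x u :
  qform (Gamma_mx PP MM C D Q Rw gamma) (col_mx x u) =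
  #|PP|%:R^-1 * (\sum_(i in PP) qform (Q i) (C i *m x + D i *m u)) -
  \sum_(j in MM) gamma j * qform (Rw j) (C j *m x + D j *m u).
Proof.
rewrite /Gamma_mx qformD qformN qformZ !qform_sum; congr (_ * _ - _).
  by apply: eq_bigr => i _; rewrite qform_output_gram.
by apply: eq_bigr => i _; rewrite qformZ qform_output_gram.
Qed.

(** A scalar equals its transpose, so with [P] symmetric the two halves of the block form coincide;
    this produces the factor 2 of the derivative of [x^T P x]. *)
Lemma qform_storage n m (A : 'M[R]_n) (B : 'M[R]_(n, m)) (P : 'M[R]_n) x u :
  P^T = P ->
  qform (block_mx (A^T *m P + P *m A) (P *m B) (B^T *m P) 0) (col_mx x u) =
  2 * (x^T *m P *m (A *m x + B *m u)) 0 0.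
Proof.
move=> Ps; set y := A *m x + B *m u; pose b := x^T *m P *m y.
have bT : b 0 0 = (y^T *m P *m x) 0 0.
  transitivity (b^T 0 0); first by rewrite [RHS]mxE.
  by rewrite /b !trmx_mul trmxK Ps mulmxA.
rewrite -/b mulr_natl mulr2n {2}bT /qform -mulmxA mul_block_col mul0mx addr0.
rewrite tr_col_mx mul_row_col /b /y [(_ + _)^T]raddfD /= !trmx_mul.
rewrite !(mulmxDl, mulmxDr) !mulmxA !mxE; ring.
Qed.

(** The matrix inequality evaluated at the stacked vector [(x, u)]. The vectors are arbitrary, so
    the bound applies both pointwise along trajectories and to the real and imaginary parts of a
    zero direction. *)
Lemma sdp_dissipation N n m (PP MM : {set 'I_N}) (p : 'I_N -> nat)
    (A : 'M[R]_n) (B : 'M[R]_(n, m))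
    (C : forall i, 'M[R]_(p i, n)) (D : forall i, 'M[R]_(p i, m))
    (Q Rw : forall i, 'M[R]_(p i)) (gamma : 'I_N -> R) P x u :
  sdp_feasible PP MM A B C D Q Rw gamma P ->
  2 * (x^T *m P *m (A *m x + B *m u)) 0 0 +
  #|PP|%:R^-1 * (\sum_(i in PP) qform (Q i) (C i *m x + D i *m u)) <=
  \sum_(j in MM) gamma j * qform (Rw j) (C j *m x + D j *m u).
Proof.
case=> -[_ /(_ (col_mx x u))] + _ [_ [Ps _]] _ _.
rewrite qformN qformD qform_storage // qform_Gamma; lra.
Qed.

Lemma qform_psd_sqrt n (Q : 'M[R]_n) v : psdmx Q ->
  qform Q v = \sum_k (psd_sqrt Q *m v) k 0 ^+ 2.
Proof. by move=> /psd_sqrtP[[Ss _] SS]; rewrite -{1}SS -{1}Ss qform_gram. Qed.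

Lemma qform_psd_eq0 n (Q : 'M[R]_n) v : psdmx Q ->
  qform Q v = 0 <-> psd_sqrt Q *m v = 0.
Proof.
move=> /qform_psd_sqrt ->; split=> [h|->]; last first.
  by apply: big1 => k _; rewrite mxE expr0n.
apply/colP => k; rewrite [RHS]mxE.
have /psumr_eq0P/(_ h k isT)/eqP :
    forall k : 'I_n, true -> 0 <= (psd_sqrt Q *m v) k 0 ^+ 2.
  by move=> *; exact: sqr_ge0.
by rewrite sqrf_eq0 => /eqP.
Qed.

(** This removes the square roots from the definition of a zero: a stacked output vanishes exactly
    when each weighted energy does, and only these energies occur in the dissipation inequality. *)
Lemma weighted_stack_eq0 N n m (S : {set 'I_N}) (p : 'I_N -> nat)
    (W : forall i, 'M[R]_(p i)) (K : forall i, 'M[R]_(p i, n))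
    (L : forall i, 'M[R]_(p i, m)) x u :
  (forall i, i \in S -> psdmx (W i)) ->
  weighted_stack S W K *m x - weighted_stack S W L *m u = 0 <->
  (forall i, i \in S -> qform (W i) (K i *m x - L i *m u) = 0).
Proof.
move=> Wpsd; rewrite /weighted_stack !mxcol_mul -mxcolB; split=> [h i iS|h].
  apply/(qform_psd_eq0 _ (Wpsd _ iS)).
  (* Blocks are indexed by position in the enumeration of [S], so the block of [i] is found at its
     rank. *)
  pose k := enum_rank_in iS i.
  have /(congr1 (fun X => submxcol X k)) := h.
  rewrite /= mxcolK submxcol0 -!mulmxA -mulmxBr.
  by rewrite /k enum_rankK_in.
apply/eqP; rewrite -mxcol0; apply/eqP/eq_mxcol => k.
have kS := enum_valP k.
by rewrite -!mulmxA -mulmxBr; apply/(qform_psd_eq0 _ (Wpsd _ kS))/h.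
Qed.

End quadratic_forms.

(** * Imaginary zeros and infeasibility of the semidefinite program *)

Section imaginary_zeros.
Context (R : realType).

Lemma ReM_mx m n (A : 'M[R]_(m, n)) (z : 'cV[R[i]]_n) :
  map_mx (@complex.Re R) (map_mx (real_complex R) A *m z) =
  A *m map_mx (@complex.Re R) z.
Proof.
apply/colP => k; rewrite !mxE.
rewrite (big_morph (@complex.Re R) (id1 := 0) (op1 := +%R)) //; last first.
  by case=> ? ? [].
by apply: eq_bigr => j _; rewrite !mxE; case: (z j 0) => a b /=;
  rewrite mul0r subr0.
Qed.

Lemma ImM_mx m n (A : 'M[R]_(m, n)) (z : 'cV[R[i]]_n) :
  map_mx (@complex.Im R) (map_mx (real_complex R) A *m z) =
  A *m map_mx (@complex.Im R) z.
Proof.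
apply/colP => k; rewrite !mxE.
rewrite (big_morph (@complex.Im R) (id1 := 0) (op1 := +%R)) //; last first.
  by case=> ? ? [].
by apply: eq_bigr => j _; rewrite !mxE; case: (z j 0) => a b /=;
  rewrite mul0r addr0.
Qed.

Lemma complex_mx_eqP m n (y z : 'M[R[i]]_(m, n)) :
  y = z <-> map_mx (@complex.Re R) y = map_mx (@complex.Re R) z /\
            map_mx (@complex.Im R) y = map_mx (@complex.Im R) z.
Proof.
split=> [->//|[/matrixP re /matrixP im]]; apply/matrixP => i j.
have := re i j; have := im i j; rewrite !mxE.
by case: (y i j) (z i j) => a b [c d] /= -> ->.
Qed.

Lemma real_output_eq0 n m p (C : 'M[R]_(p, n)) (D : 'M[R]_(p, m)) (x : 'cV[R[i]]_n)
    (g : 'cV[R[i]]_m) :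
  map_mx (real_complex R) C *m x = map_mx (real_complex R) D *m g <->
  C *m map_mx (@complex.Re R) x - D *m map_mx (@complex.Re R) g = 0 /\
  C *m map_mx (@complex.Im R) x - D *m map_mx (@complex.Im R) g = 0.
Proof.
rewrite complex_mx_eqP !ReM_mx !ImM_mx.
by split=> -[/eqP r /eqP i]; split; apply/eqP; move: r i; rewrite !subr_eq0.
Qed.

(** The signs in the pencil make [- g] the actual input: the equations read [A x + B (- g) = beta x]
    and [C x + D (- g) = 0]. *)
Lemma system_zeroE n m p (A : 'M[R]_n) (B : 'M[R]_(n, m)) (C : 'M[R]_(p, n))
    (D : 'M[R]_(p, m)) beta :
  system_zero A B C D beta <->
  exists (x : 'cV[R[i]]_n) (g : 'cV[R[i]]_m), [/\ ~ (x = 0 /\ g = 0),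
    map_mx (real_complex R) A *m x =
      beta *: x + map_mx (real_complex R) B *m g &
    map_mx (real_complex R) C *m x = map_mx (real_complex R) D *m g].
Proof.
split=> -[x [g]].
  case=> nz; rewrite mul_block_col mulNmx mulmxBl mul_scalar_mx -col_mx0.
  case/eq_col_mx => /eqP + /eqP; rewrite addrAC !subr_eq0.
  move=> /eqP xE /eqP gE.
  by exists x, g; split.
case=> nz xE gE; exists x, g; split=> //.
rewrite mul_block_col mulNmx mulmxBl mul_scalar_mx xE gE subrr opprD addrA subrr.
by rewrite sub0r addNr col_mx0.
Qed.

(** The Hermitian form at [(x, - g)] is the sum of the real forms at the real and imaginary parts,
    so two instances of [sdp_dissipation] are added. The storage terms cancel and the constraint
    energies vanish, which forces the nonnegative performance sums [S1] and [S2] to be zero. *)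
Lemma sdp_infeasible_of_zero N n m (PP MM : {set 'I_N}) (p : 'I_N -> nat)
    (A : 'M[R]_n) (B : 'M[R]_(n, m))
    (C : forall i, 'M[R]_(p i, n)) (D : forall i, 'M[R]_(p i, m))
    (Q Rw : forall i, 'M[R]_(p i)) (beta : R[i]) :
  PP != finset.set0 ->
  (forall i, i \in PP -> psdmx (Q i)) -> (forall j, j \in MM -> psdmx (Rw j)) ->
  complex.Re beta = 0 -> zero_of_Sigma_m MM A B C D Rw beta ->
  ~ zero_of_Sigma_p PP A B C D Q beta ->
  forall gamma P, ~ sdp_feasible PP MM A B C D Q Rw gamma P.
Proof.
move=> PP0 Qpsd Rpsd bre /system_zeroE[x [g [nz xE mE]]] nzp gamma P feas.
have PPpos : 0 < #|PP|%:R :> R by rewrite ltr0n card_gt0.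
have [w bE] : exists w, beta = Complex 0 w.
  by case: beta bre {xE nzp} => a b /= ->; exists b.
apply: nzp; apply/system_zeroE; exists x, g; split=> //.
(* The normalization of the performance output is common to both sides and drops out. *)
rewrite !map_mxZ -!scalemxAl; congr (_ *: _).
set x1 := map_mx (@complex.Re R) x; set x2 := map_mx (@complex.Im R) x.
set g1 := map_mx (@complex.Re R) g; set g2 := map_mx (@complex.Im R) g.
rewrite bE in xE.
(* Multiplication by [i w] rotates: its real part on [x1 + i x2] is [- w x2], its imaginary part
   [w x1]. *)
have e1 : A *m x1 + B *m (- g1) = - w *: x2.
  rewrite mulmxN -!ReM_mx xE /x1 /x2; move: (_ *m g) => v.
  apply/colP => k; rewrite !mxE.
  case: (x k 0) => c d; case: (v k 0) => c' d' /=; ring.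
have e2 : A *m x2 + B *m (- g2) = w *: x1.
  rewrite mulmxN -!ImM_mx xE /x1 /x2; move: (_ *m g) => v.
  apply/colP => k; rewrite !mxE.
  case: (x k 0) => c d; case: (v k 0) => c' d' /=; ring.
have [m1 m2] := (real_output_eq0 _ _ _ _).1 mE.
have d1 := sdp_dissipation x1 (- g1) feas.
have d2 := sdp_dissipation x2 (- g2) feas.
(* By symmetry of [P], the storage terms [- w x1^T P x2] and [w x2^T P x1] are opposite. *)
have cross : (x2^T *m P *m x1) 0 0 = (x1^T *m P *m x2) 0 0.
  case: feas => _ _ [_ [Ps _]] _ _.
  transitivity ((x2^T *m P *m x1)^T 0 0); first by rewrite [RHS]mxE.
  by rewrite !trmx_mul trmxK Ps mulmxA.
rewrite e1 e2 in d1 d2.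
have s0 (y : 'cV[R]_n) h :
  weighted_stack MM Rw C *m y - weighted_stack MM Rw D *m h = 0 ->
  \sum_(j in MM) gamma j * qform (Rw j) (C j *m y + D j *m (- h)) = 0.
  move=> /(weighted_stack_eq0 _ _ _ _ Rpsd) h0.
  by apply: big1 => j jM; rewrite mulmxN h0 // mulr0.
rewrite (s0 _ _ m1) in d1; rewrite (s0 _ _ m2) in d2.
have Qge0 i v : i \in PP -> 0 <= qform (Q i) v by move=> /Qpsd[].
set S1 := \sum_(i in PP) _ in d1; set S2 := \sum_(i in PP) _ in d2.
have S1ge : 0 <= S1 by apply: sumr_ge0 => i iP; exact: Qge0.
have S2ge : 0 <= S2 by apply: sumr_ge0 => i iP; exact: Qge0.
have S12 : S1 + S2 <= 0.
  rewrite -(pmulr_rle0 _ (_ : 0 < #|PP|%:R^-1)) ?invr_gt0 //.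
  have scale00 a (X : 'M[R]_1) : (a *: X) 0 0 = a * X 0 0 by rewrite mxE.
  move: d1 d2; rewrite -!scalemxAr !scale00 cross mulrDr; lra.
have S1E : S1 = 0 by lra.
have S2E : S2 = 0 by lra.
apply/real_output_eq0; split; apply/(weighted_stack_eq0 _ _ _ _ Qpsd) => i iP.
  move/psumr_eq0P: S1E; rewrite -mulmxN; apply => // *; exact: Qge0.
move/psumr_eq0P: S2E; rewrite -mulmxN; apply => // *; exact: Qge0.
Qed.

End imaginary_zeros.

(** * Squares, continuity and boundedness of primitives of integrable functions *)

Section primitives.
Context (R : realType).
Notation mu := (@lebesgue_measure R).

(* Fubini on the half plane below the diagonal: integrating first over either
   variable gives [\int g G] and [\int g (I - G)]. *)
Lemma primitive_sq (g : R -> R) : mu.-integrable setT (EFin \o g) ->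
  let G t := \int[mu]_(s in `]-oo, t]) g s in
  2 * \int[mu]_t (g t * G t) = (\int[mu]_t g t) ^+ 2.
Proof.
move=> ig G; set I := \int[mu]_t g t.
have mg : measurable_fun setT g by apply/measurable_EFinP; case/integrableP: ig.
have igD (D : set R) : measurable D -> mu.-integrable D (EFin \o g).
  by move=> mD; apply: integrableS ig.
have IgD (D : set R) : measurable D ->
    (\int[mu]_(x in D) (g x)%:E = (\int[mu]_(x in D) g x)%:E)%E.
  move=> mD; rewrite /Rintegral fineK //.
  by apply: integrable_fin_num => //; exact: igD.
pose below := [set z : R * R | (z.2 <= z.1)%R].
pose F (z : R * R) := (g z.1 * g z.2 * \1_below z)%:E.
have mF : measurable_fun setT F.
  apply/measurable_EFinP; apply: measurable_funM.
    apply: measurable_funM.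
      by apply: measurableT_comp => //; exact: measurable_fst.
    by apply: measurableT_comp => //; exact: measurable_snd.
  apply: measurable_indic; rewrite -[below]setTI.
  exact: measurable_fun_le.
have /integrableP[mag] : mu.-integrable setT (abse \o (EFin \o g)).
  exact: integrable_abse.
under eq_integral do rewrite /= normr_id.
set J := (\int[mu]_x _)%E => Joo.
have J0 : (0 <= J)%E by apply: integral_ge0.
have maF : measurable_fun setT (abse \o F) by exact: measurableT_comp.
have iF : (mu \x mu)%E.-integrable setT F.
  apply/integrable12ltyP => //.
  (* Since [|F (s, t)|] is at most [|g s| |g t|], its iterated integral is bounded by the finite
     number [J ^ 2], which licenses Fubini. *)
  apply: (@le_lt_trans _ _ (\int[mu]_x (`|(g x)%:E| * J))%E).
    apply: ge0_le_integral => //.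
    - by move=> x _; apply: integral_ge0.
    - exact: (measurable_fun_fubini_tonelli_F (m2 := mu) _ maF (fun z => abse_ge0 (F z))).
    - exact: emeasurable_funM.
    - move=> x _; rewrite /J -ge0_integralZl //=.
      apply: ge0_le_integral => //.
      + exact: (measurableT_comp maF (pair1_measurable x)).
      + exact: emeasurable_funM.
      + move=> y _; rewrite /F /= lee_fin indicE !normrM.
        by case: (_ \in _); rewrite ?normr1 ?normr0 ?mulr1 ?mulr0 ?mulr_ge0.
  rewrite ge0_integralZr // lte_mul_pinfty // ge0_fin_numE //.
have e1 s : (\int[mu]_t F (s, t) = (g s * G s)%:E)%E.
  transitivity (\int[mu]_(t in `]-oo, s]) ((g s)%:E * (g t)%:E))%E.
    rewrite [RHS]integral_mkcond; apply: eq_integral => t _.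
    rewrite patchE /F /= indicE set_itvE.
    rewrite (_ : ((s, t) \in below) = (t \in [set z | (z <= s)%O])); last first.
      by apply/idP/idP; rewrite !inE.
    by case: ifPn => _; rewrite ?mulr0 ?mulr1.
  by rewrite integralZl // ?IgD //; exact: igD.
have e2 t : (\int[mu]_s F (s, t) = (g t * (I - G t))%:E)%E.
  transitivity (\int[mu]_(s in `[t, +oo[) ((g t)%:E * (g s)%:E))%E.
    rewrite [RHS]integral_mkcond; apply: eq_integral => s _.
    rewrite patchE /F /= indicE set_itvE.
    rewrite (_ : ((s, t) \in below) = (s \in [set z | (t <= z)%O])); last first.
      by apply/idP/idP; rewrite !inE.
    by case: ifPn => _; rewrite ?mulr0 ?mulr1 // mulrC.
  rewrite integralZl // ?IgD //; last exact: igD.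
  (* Dropping the null point [t] leaves the open ray, the complement of the ray that defines
     [G t]. *)
  rewrite -Rintegral_itv_obnd_cbnd; last exact: igD.
  rewrite -(@Rintegral_itvB _ g -oo%O +oo%O t) //; last exact: igD.
  by rewrite set_itvNyy.
have igG : mu.-integrable setT (EFin \o (fun t => g t * G t)).
  have := integrable_fubini_F iF.
  by apply: eq_integrable => // t _; exact: e1.
have /= := Fubini iF.
under eq_integral do rewrite e1.
under [in X in _ = X -> _]eq_integral do rewrite e2.
move=> /(congr1 fine) h.
have {}h : \int[mu]_t (g t * G t) = \int[mu]_t (g t * (I - G t)) by [].
(* Replacing one of the two copies through [h] gives the integrand [g ((I - G) + G) = g I]. *)
rewrite mulr_natl mulr2n {1}h -RintegralD //; last first.
  have : mu.-integrable setT
      ((fun t => I%:E * (g t)%:E) \- (EFin \o (fun t => g t * G t)%R))%E.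
    by apply: integrableB => //; exact: integrableZl.
  by apply: eq_integrable => // t _ /=; rewrite -EFinM -EFinB; congr EFin; ring.
under eq_Rintegral do rewrite -mulrDr subrK.
by rewrite RintegralZr // expr2.
Qed.

(** Extending [f] by zero outside [[0, T]] reduces this to the whole line: the total integral
    becomes [X T], and for [t] in [[0, T]] the integral up to [t] becomes [X t]. *)
Lemma primitive_sq_itv (f X : R -> R) (T : R) : 0 <= T ->
  mu.-integrable `[0, T] (EFin \o f) ->
  (forall t, 0 <= t <= T -> X t = \int[mu]_(s in `[0, t]) f s) ->
  2 * \int[mu]_(t in `[0, T]) (f t * X t) = X T ^+ 2.
Proof.
move=> T0 fi XE.
have mT : measurable (`[0, T] : set R) by exact: measurable_itv.
have gi : mu.-integrable setT (EFin \o (f \_ `[0, T])).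
  by rewrite -restrict_EFin; apply/integrable_restrict => //=; rewrite setTI.
have := primitive_sq gi.
rewrite /= -Rintegral_mkcond -XE ?T0 ?lexx // => <-; congr (_ * _).
rewrite Rintegral_mkcond; apply: eq_Rintegral => t _.
rewrite !patchE; case: ifPn => [|_]; last by rewrite mul0r.
rewrite inE /= in_itv /= => t0T; rewrite XE // -Rintegral_mkcondr.
congr (_ * Rintegral _ _ _); apply/seteqP; split=> s /=; rewrite !in_itv /=.
  by case/andP: t0T => t0 tT /andP[s0 st]; rewrite st s0 (le_trans st).
by case=> st /andP[-> _].
Qed.

(** On the compact interval [X] agrees with a continuous parameterized integral. Measurability and
    boundedness are what products with an integrable factor require. *)
Lemma primitive_continuous (f X : R -> R) (T : R) : 0 <= T ->
  mu.-integrable `[0, T] (EFin \o f) ->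
  (forall t, 0 <= t <= T -> X t = \int[mu]_(s in `[0, t]) f s) ->
  measurable_fun `[0, T] X /\ [bounded X t | t in `[0, T]].
Proof.
move=> T0 fi XE.
have mT : measurable (`[0, T] : set R) by exact: measurable_itv.
pose Y t := parameterized_integral mu 0 t f.
have cY : {within `[0, T], continuous Y}.
  exact: parameterized_integral_continuous.
have XY : {in `[0, T], Y =1 X} by move=> t t0T; rewrite XE // -in_itv.
split.
  have : measurable_fun `[0, T] Y by exact: subspace_continuous_measurable_fun.
  by apply: eq_measurable_fun => t; rewrite inE => /XY.
have /compact_bounded[M [Mr MP]] := continuous_compact cY (@segment_compact R 0 T).
exists M; split=> // M' /MP hM' t t0T /=.
by rewrite -XY //; apply: hM'; exists t.
Qed.

Lemma bounded_measurable_integrable_itv (h : R -> R) (T : R) :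
  measurable_fun `[0, T] h -> [bounded h t | t in `[0, T]] ->
  mu.-integrable `[0, T] (EFin \o h).
Proof.
move=> mh bh; apply: measurable_bounded_integrable => //.
rewrite /= lebesgue_measure_itv /=; case: ifPn => // _.
by rewrite -EFinD ltry.
Qed.

Lemma integrable_qform n (D : set R) (z : R -> 'cV[R]_n) (M : 'M[R]_n) :
  measurable D ->
  (forall a b, mu.-integrable D (fun t => (z t a 0 * z t b 0)%:E)) ->
  mu.-integrable D (fun t => (qform M (z t))%:E).
Proof.
move=> mD zi.
have : mu.-integrable D (fun t =>
    \sum_a \sum_b (M a b)%:E * (z t a 0 * z t b 0)%:E)%E.
  apply: integrable_sum => // a _; apply: integrable_sum => // b _.
  exact: integrableZl.
apply: eq_integrable => // t _; rewrite /qform -mulmxA mxE -sumEFin.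
apply: eq_bigr => a _; rewrite !mxE mulr_sumr -sumEFin.
by apply: eq_bigr => b _; rewrite -EFinM; congr EFin; ring.
Qed.

Lemma Rintegral_sum (I : Type) (s : seq I) (D : set R) (f : I -> R -> R) :
  measurable D -> (forall i, mu.-integrable D (EFin \o f i)) ->
  \int[mu]_(t in D) (\sum_(i <- s) f i t) =
  \sum_(i <- s) \int[mu]_(t in D) f i t.
Proof.
move=> mD fi; rewrite /Rintegral.
under eq_integral do rewrite -sumEFin.
rewrite integral_sum // -sum_fine // => i _.
by apply: integrable_fin_num => //; exact: fi.
Qed.

End primitives.

(** * Integrability along a trajectory and the storage balance on [[0, T]] *)

Section dissipativity.
Context (R : realType) (n m : nat) (A : 'M[R]_n) (B : 'M[R]_(n, m)).
Context (u : R -> 'cV[R]_m) (x : R -> 'cV[R]_n).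
Hypotheses (hu : L2_0plus u) (hx : trajectory A B u x).
Notation mu := (@lebesgue_measure R).

Let z t : 'cV[R]_(n + m) := col_mx (x t) (u t).

Lemma trajectory_regular (T : R) k : 0 <= T ->
  measurable_fun `[0, T] (fun t => x t k 0) /\
  [bounded x t k 0 | t in `[0, T]].
Proof.
move=> T0; apply: (primitive_continuous T0 (hx k T0).1) => t /andP[t0 _].
exact: (hx k t0).2.
Qed.

Lemma state_mul_integrable (T : R) k (h : R -> R) : 0 <= T ->
  mu.-integrable `[0, T] (EFin \o h) ->
  mu.-integrable `[0, T] (fun t => (x t k 0 * h t)%:E).
Proof.
move=> T0 hi; have [mx bx] := trajectory_regular k T0.
have : mu.-integrable `[0, T]
    ((EFin \o (fun t => x t k 0)%R) \* (EFin \o h))%E by exact: integrableMr.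
exact: eq_integrable.
Qed.

(** The product is dominated by the integrable [u^T u], because [2 |a b| <= a^2 + b^2]. *)
Lemma input_prod_integrable (T : R) k l : 0 <= T ->
  mu.-integrable `[0, T] (fun t => (u t k 0 * u t l 0)%:E).
Proof.
move=> T0; case: hu => mu_ _ uoo _.
have sub : `[0, T] `<=` (`[0, +oo[ : set R).
  by move=> t /=; rewrite !in_itv /= => /andP[->].
have mS : measurable_fun (`[0, +oo[ : set R) (fun t => ((u t)^T *m u t) 0 0).
  have : measurable_fun (`[0, +oo[ : set R) (fun t => \sum_j u t j 0 * u t j 0).
    by apply: measurable_sum => j; exact: measurable_funM.
  apply: eq_measurable_fun => t _; rewrite mxE.
  by apply: eq_bigr => j _; rewrite mxE.
have sE t : ((u t)^T *m u t) 0 0 = \sum_j u t j 0 ^+ 2.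
  by rewrite mxE; apply: eq_bigr => j _; rewrite mxE expr2.
have s0 t : 0 <= ((u t)^T *m u t) 0 0.
  by rewrite sE; apply: sumr_ge0 => j _; exact: sqr_ge0.
have iS : mu.-integrable `[0, T] (fun t => (((u t)^T *m u t) 0 0)%:E).
  have : mu.-integrable `[0, +oo[ (fun t => (((u t)^T *m u t) 0 0)%:E).
    apply/integrableP; split; first exact/measurable_EFinP.
    by under eq_integral do rewrite gee0_abs ?lee_fin //.
  by apply: integrableS.
apply: le_integrable iS => //.
  apply/measurable_EFinP; apply: measurable_funM.
    exact: (measurable_funS _ sub (mu_ k)).
  exact: (measurable_funS _ sub (mu_ l)).
move=> t _; rewrite lee_fin (ger0_norm (s0 t)) normrM.
have le_s j : `|u t j 0| ^+ 2 <= ((u t)^T *m u t) 0 0.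
  rewrite sE (bigD1 j) //= -normrX ger0_norm ?sqr_ge0 // lerDl.
  by apply: sumr_ge0 => i _; exact: sqr_ge0.
have := le_s k; have := le_s l; have := sqr_ge0 (`|u t k 0| - `|u t l 0|).
rewrite sqrrB; nra.
Qed.

(** On a bounded interval square integrability suffices, by the domination [|a| <= 1 + a^2]. *)
Lemma input_integrable (T : R) k : 0 <= T ->
  mu.-integrable `[0, T] (fun t => (u t k 0)%:E).
Proof.
move=> T0; case: (hu) => mu_ _ _ _.
have sub : `[0, T] `<=` (`[0, +oo[ : set R).
  by move=> t /=; rewrite !in_itv /= => /andP[->].
have i1 : mu.-integrable `[0, T] (EFin \o cst (1 : R)).
  by apply: bounded_measurable_integrable_itv => //; exact: bounded_cst.
apply: le_integrable (integrableD _ i1 (input_prod_integrable k k T0)) => //.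
  by apply/measurable_EFinP; exact: (measurable_funS _ sub (mu_ k)).
move=> t _; rewrite /= lee_fin.
apply: le_trans (ler_norm _); move: (u t k 0) => a.
have := sqr_ge0 (`|a| - 1); rewrite -expr2 -(real_normK (num_real a)).
have := normr_ge0 a; nra.
Qed.

(** A product with a state factor is a bounded measurable function times an integrable one; a
    product of two inputs is covered by square integrability. *)
Lemma signal_prod_integrable (T : R) a b : 0 <= T ->
  mu.-integrable `[0, T] (fun t => (z t a 0 * z t b 0)%:E).
Proof.
move=> T0.
have xi k h := @state_mul_integrable T k h T0.
rewrite /z; case: (split_ordP a) (split_ordP b) => k -> [] l ->.
- have [mx bx] := trajectory_regular l T0.
  have := xi k _ (bounded_measurable_integrable_itv mx bx).
  by apply: eq_integrable => // t _; rewrite !col_mxEu.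
- have := xi k _ (input_integrable l T0).
  by apply: eq_integrable => // t _; rewrite col_mxEu col_mxEd.
- have := xi l _ (input_integrable k T0).
  by apply: eq_integrable => // t _; rewrite col_mxEu col_mxEd mulrC.
- have := input_prod_integrable k l T0.
  by apply: eq_integrable => // t _; rewrite !col_mxEd.
Qed.

Lemma qform_signal_integrable (T : R) M : 0 <= T ->
  mu.-integrable `[0, T] (fun t => (qform M (z t))%:E).
Proof.
move=> T0; apply: integrable_qform => // a b.
exact: signal_prod_integrable.
Qed.

Lemma output_integrable p (C : 'M[R]_(p, n)) (D : 'M[R]_(p, m)) Q (T : R) :
  0 <= T ->
  mu.-integrable `[0, T] (fun t => (qform Q (C *m x t + D *m u t))%:E).
Proof.
move=> T0; have := qform_signal_integrable (output_gram C D Q) T0.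
by apply: eq_integrable => // t _; rewrite qform_output_gram.
Qed.

(** Integrability is only known on bounded horizons, so measurability is glued over the intervals
    [[0, k + 1]]. *)
Lemma output_measurable p (C : 'M[R]_(p, n)) (D : 'M[R]_(p, m)) Q :
  measurable_fun (`[0, +oo[ : set R) (fun t => qform Q (C *m x t + D *m u t)).
Proof.
rewrite itv0y_bigcup0S; apply/measurable_fun_bigcup => // k.
by have /integrableP[/measurable_EFinP] := output_integrable C D Q (ler0n R k.+1).
Qed.

Lemma output_energy_ge_itv p (C : 'M[R]_(p, n)) (D : 'M[R]_(p, m)) Q (T : R) :
  psdmx Q ->
  (\int[mu]_(t in `[0%R, T]) (qform Q (C *m x t + D *m u t))%:E <=
   output_energy C D Q u x)%E.
Proof.
move=> [_ Q0]; apply: ge0_subset_integral => //.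
- by have /measurable_EFinP := output_measurable C D Q.
- by move=> t _; rewrite lee_fin.
- by move=> t /=; rewrite !in_itv /= => /andP[->].
Qed.

Lemma storage_integral (P : 'M[R]_n) (T : R) : 0 <= T -> is_diag_mx P ->
  \int[mu]_(t in `[0, T]) (2 * ((x t)^T *m P *m (A *m x t + B *m u t)) 0 0) =
  qform P (x T).
Proof.
move=> T0 /is_diag_mxP Pd.
have bilE (v w : 'cV[R]_n) : (v^T *m P *m w) 0 0 = \sum_k P k k * (w k 0 * v k 0).
  rewrite -mulmxA mxE; apply: eq_bigr => k _; rewrite !mxE (bigD1 k) //=.
  rewrite big1 ?addr0; last first.
    by move=> l /negP lk; rewrite Pd ?mul0r // eq_sym; apply/negP.
  by ring.
have fx k : mu.-integrable `[0, T]
    (fun t => (vector_field A B u x t k 0 * x t k 0)%:E).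
  have := state_mul_integrable k T0 (hx k T0).1.
  by apply: eq_integrable => // t _; rewrite mulrC.
under eq_Rintegral do rewrite bilE mulr_sumr.
rewrite Rintegral_sum //; last first.
  move=> k.
  have : mu.-integrable `[0, T] (fun t => (2 * P k k)%:E *
      (vector_field A B u x t k 0 * x t k 0)%:E)%E by exact: integrableZl.
  by apply: eq_integrable => // t _; rewrite -EFinM -mulrA.
rewrite /qform bilE; apply: eq_bigr => k _.
under eq_Rintegral do rewrite mulrA.
rewrite RintegralZl //; last exact: fx.
rewrite (mulrC 2) -mulrA; congr (_ * _).
(* Each diagonal entry weighs [x_k(T)^2], which is twice the integral of [x_k] times its
   derivative. *)
rewrite -expr2 -(@primitive_sq_itv _ (fun t => vector_field A B u x t k 0)
  (fun t => x t k 0)) //.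
  exact: (hx k T0).1.
by move=> t /andP[t0 _]; exact: (hx k t0).2.
Qed.

(** * Weak duality between one feasible input and one feasible multiplier *)

Section duality_gap.
Context (N : nat) (PP MM : {set 'I_N}) (p : 'I_N -> nat).
Context (C : forall i, 'M[R]_(p i, n)) (D : forall i, 'M[R]_(p i, m)).
Context (Q Rw : forall i, 'M[R]_(p i)) (delta : 'I_N -> R).
Hypotheses (Qpsd : forall i, i \in PP -> psdmx (Q i)).
Hypotheses (Rpsd : forall j, j \in MM -> psdmx (Rw j)).
Variables (gamma : 'I_N -> R) (P : 'M[R]_n).
Hypothesis feas : sdp_feasible PP MM A B C D Q Rw gamma P.
Hypothesis budget : forall j, j \in MM ->
  (output_energy (C j) (D j) (Rw j) u x <= (delta j)%:E)%E.

Let q t := #|PP|%:R^-1 * \sum_(i in PP) qform (Q i) (C i *m x t + D i *m u t).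
Let r t := \sum_(j in MM) gamma j * qform (Rw j) (C j *m x t + D j *m u t).
Let storage t := 2 * ((x t)^T *m P *m (A *m x t + B *m u t)) 0 0.

Lemma weighted_performance_ge0 t : 0 <= q t.
Proof.
by rewrite mulr_ge0 ?invr_ge0 ?ler0n // sumr_ge0 // => i /Qpsd[].
Qed.

(** On a bounded horizon every term of the dissipation inequality is integrable, so the integral may
    be split into storage and performance as real numbers. *)
Lemma truncated_performance_le (T : R) : 0 <= T ->
  (\int[mu]_(t in `[0%R, T]) (q t)%:E <= (\sum_(j in MM) gamma j * delta j)%:E)%E.
Proof.
move=> T0; have [_ gamma0 [Pd Ppsd] _ _] := feas.
have mT : measurable (`[0, T] : set R) by exact: measurable_itv.
have qi : mu.-integrable `[0, T] (EFin \o q).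
  have := qform_signal_integrable
    (#|PP|%:R^-1 *: \sum_(i in PP) output_gram (C i) (D i) (Q i)) T0.
  apply: eq_integrable => // t _; rewrite qformZ qform_sum; congr (_ * _)%:E.
  by apply: eq_bigr => i _; rewrite qform_output_gram.
have ri j : mu.-integrable `[0, T]
    (EFin \o (fun t => gamma j * qform (Rw j) (C j *m x t + D j *m u t))).
  have := qform_signal_integrable (gamma j *: output_gram (C j) (D j) (Rw j)) T0.
  by apply: eq_integrable => // t _; rewrite qformZ qform_output_gram.
have si : mu.-integrable `[0, T] (EFin \o storage).
  have := qform_signal_integrable
    (block_mx (A^T *m P + P *m A) (P *m B) (B^T *m P) 0) T0.
  by apply: eq_integrable => // t _; rewrite qform_storage //; case: Ppsd.
have rsi : mu.-integrable `[0, T] (EFin \o r).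
  have : mu.-integrable `[0, T] (fun t => \sum_(j in MM)
      (gamma j * qform (Rw j) (C j *m x t + D j *m u t))%:E)%E.
    by apply: integrable_sum => // j _; exact: ri.
  by apply: eq_integrable => // t _; rewrite sumEFin.
have sqr_le : \int[mu]_(t in `[0, T]) (storage t + q t) <=
    \int[mu]_(t in `[0, T]) r t.
  apply: le_Rintegral => // [|t _]; last exact: sdp_dissipation.
  have : mu.-integrable `[0, T] ((EFin \o storage) \+ (EFin \o q))%E.
    exact: integrableD.
  exact: eq_integrable.
rewrite RintegralD // storage_integral // in sqr_le.
(* Since each [gamma j] is nonnegative, the truncated constraint energy may be replaced by the full
   one, hence by [delta j]. *)
have rle : \int[mu]_(t in `[0, T]) r t <= \sum_(j in MM) gamma j * delta j.
  rewrite -lee_fin /Rintegral fineK; last exact: integrable_fin_num.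
  under eq_integral do rewrite -sumEFin.
  rewrite integral_sum // -sumEFin; apply: lee_sum => j jM.
  under eq_integral do rewrite EFinM.
  rewrite ge0_integralZl //.
  - rewrite EFinM; apply: lee_wpmul2l; first by rewrite lee_fin gamma0.
    exact: le_trans (output_energy_ge_itv _ _ _ (Rpsd jM)) (budget jM).
  - by have /integrableP[] := output_integrable (C j) (D j) (Rw j) T0.
  - by move=> t _; rewrite lee_fin; case: (Rpsd jM).
  - by rewrite lee_fin gamma0.
have -> : (\int[mu]_(t in `[0%R, T]) (q t)%:E =
    (\int[mu]_(t in `[0, T]) q t)%:E)%E.
  by rewrite /Rintegral fineK //; exact: integrable_fin_num.
rewrite lee_fin; apply: le_trans rle; apply: le_trans sqr_le.
by rewrite lerDr; case: Ppsd.
Qed.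

(** Monotone convergence along [[0, k + 1]] carries the uniform truncated bound to the half line,
    where the performance might a priori be infinite. *)
Lemma performance_le :
  ((#|PP|%:R^-1)%:E * \sum_(i in PP) output_energy (C i) (D i) (Q i) u x <=
   (\sum_(j in MM) gamma j * delta j)%:E)%E.
Proof.
(* Weights outside [PP] carry no sign; setting these terms to zero makes every summand nonnegative,
   so sum and integral can be exchanged over all indices. *)
pose f i t := if i \in PP then qform (Q i) (C i *m x t + D i *m u t) else 0.
have mf i : measurable_fun (`[0, +oo[ : set R) (f i).
  by rewrite /f; case: (i \in PP) => //; exact: output_measurable.
have f0 i t : 0 <= f i t by rewrite /f; case: ifPn => // /Qpsd[].
have qE t : q t = #|PP|%:R^-1 * \sum_i f i t by rewrite /q big_mkcond.
have mq : measurable_fun (`[0, +oo[ : set R) q.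
  apply: (@eq_measurable_fun _ _ _ _ _ (fun t => #|PP|%:R^-1 * \sum_i f i t)).
    by move=> t _; rewrite qE.
  by apply: measurable_funM => //; exact: measurable_sum.
have -> : ((#|PP|%:R^-1)%:E * \sum_(i in PP) output_energy (C i) (D i) (Q i) u x =
    \int[mu]_(t in `[0%R, +oo[) (q t)%:E)%E.
  under eq_integral do rewrite qE EFinM -sumEFin.
  rewrite ge0_integralZl //; first last.
  - by move=> t _; apply: sume_ge0 => i _; rewrite lee_fin.
  - by apply: emeasurable_sum => i; have /measurable_EFinP := mf i.
  rewrite ge0_integral_sum //; first last.
  - by move=> i t _; rewrite lee_fin.
  - by move=> i; have /measurable_EFinP := mf i.
  rewrite big_mkcond; congr (_ * _)%E; apply: eq_bigr => i _; rewrite /f.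
  by case: (i \in PP) => //; rewrite integral0.
rewrite itv0y_bigcup0S.
have cv : (\int[mu]_(t in `[0%R, k.+1%:R]) (q t)%:E @[k --> \oo] -->
    \int[mu]_(t in \bigcup_k `[0%R, k.+1%:R]%classic) (q t)%:E)%E.
  apply: ge0_nondecreasing_set_cvg_integral => //.
  - move=> k l kl; rewrite subsetEset => t /=; rewrite !in_itv /= => /andP[-> tk].
    by rewrite (le_trans tk) // ler_nat.
  - move=> k; have /measurable_EFinP := mq; apply: measurable_funS => //.
    by move=> t /=; rewrite !in_itv /= => /andP[->].
  - by move=> k t _; rewrite lee_fin weighted_performance_ge0.
rewrite -(cvg_lim _ cv) //; apply: lime_le.
  by apply/cvg_ex; eexists; exact: cv.
by apply: nearW => k; exact: truncated_performance_le.
Qed.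

End duality_gap.
End dissipativity.

Theorem theorem15 (R : realType) (N n m : nat) (PP MM : {set 'I_N})
    (p : 'I_N -> nat) (A : 'M[R]_n) (B : 'M[R]_(n, m))
    (C : forall i : 'I_N, 'M[R]_(p i, n)) (D : forall i : 'I_N, 'M[R]_(p i, m))
    (Q Rw : forall i : 'I_N, 'M[R]_(p i)) (delta : 'I_N -> R)
    (hN : (2 <= N)%N)
    (hPP : PP != finset.set0) (hMM : MM != finset.set0)
    (hdisj : (PP :&: MM)%SET = finset.set0)
    (hcover : (PP :|: MM)%SET = [set: 'I_N]%SET)
    (hA : metzler A) (hB : nonneg_mx B)
    (hC : forall i : 'I_N, nonneg_mx (C i))
    (hD : forall i : 'I_N, nonneg_mx (D i))
    (hQ : forall i : 'I_N, i \in PP -> psdmx (Q i))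
    (hRw : forall j : 'I_N, j \in MM -> psdmx (Rw j))
    (hdelta : forall j : 'I_N, j \in MM -> 0 < delta j) :
  (op_value PP MM A B C D Q Rw delta <= sdp_value PP MM A B C D Q Rw delta)%E
  /\
  ((exists beta : R[i],
      [/\ complex.Re beta = 0, zero_of_Sigma_m MM A B C D Rw beta &
          ~ zero_of_Sigma_p PP A B C D Q beta]) ->
   sdp_value PP MM A B C D Q Rw delta = +oo%E).
Proof.
split=> [|[beta [re0 zm nzp]]].
  apply: le_ereal_inf_tmp => J [gamma [P [feas {J}->]]].
  apply: ge_ereal_sup => J [u [x [[hu hx budget] {J}->]]].
  exact: performance_le feas budget.
have infeas := sdp_infeasible_of_zero hPP hQ hRw re0 zm nzp.
(* With no feasible multiplier the infimum is over the empty set, which is [+oo]. *)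
rewrite /sdp_value -[RHS]ereal_inf0; congr ereal_inf.
by apply/seteqP; split=> // J [gamma [P [/infeas]]].
Qed.
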